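(* Consider the setting without covariates and let $\ell:\mathcal D\times\mathcal Y^{\mathcal D}\to\mathbb R$ be a counterfactual loss, with associated vector $\boldsymbol\ell=\{\ell(d;\boldsymbol y)\}_{d\in\mathcal D,\boldsymbol y\in\mathcal Y^{\mathcal D}}\in\mathbb R^{KM^K}$. The counterfactual risk difference $R_P(\pi;\ell)-R_P(\rho;\ell)$ is identifiable for every pair of policies $\pi,\rho\in\Delta(\mathcal D)$ if and only if the linear system $$\boldsymbol A^{\mathrm{add}}\boldsymbol w^{\mathrm{add}}=\boldsymbol\ell$$ has a solution $\boldsymbol w^{\mathrm{add}}\in\mathbb R^{K^2M+M^K}$.
   Context: Setup (no covariates). $K,M\ge 2$ are integers, $\mathcal D=\{0,\dots,K-1\}$ (decisions), $\mathcal Y=\{0,\dots,M-1\}$ (outcomes), $\Delta(S)$ is the set of probability distributions on $S$. Potential outcomes are $Y(k)\in\mathcal Y$, $k\in\mathcal D$, with $Y(\mathcal D)=(Y(0),\dots,Y(K-1))\in\mathcal Y^{\mathcal D}$; $D\in\mathcal D$ is the observed decision and the observed outcome is $Y=Y(D)$ (consistency). $\mathcal P$ is the set of all joint laws $P$ of $(D,Y(\mathcal D))$ satisfying strong ignorability: $D$ is independent of $Y(\mathcal D)$ (unconfoundedness) and $P(D=d)>0$ for every $d\in\mathcal D$ (overlap); the law of $Y(\mathcal D)$ is otherwise arbitrary. The observed law $Q_P$ is $Q_P(D=k,Y=y)=P(D=k,Y(k)=y)$. A policy is an element $\pi\in\Delta(\mathcal D)$. The counterfactual risk is $R_P(\pi;\ell)=\sum_{d\in\mathcal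 D}\sum_{\boldsymbol y\in\mathcal Y^{\mathcal D}}\ell(d;\boldsymbol y)\,\pi(d)\,P(Y(\mathcal D)=\boldsymbol y)$. A functional $\theta:\mathcal P\to\mathbb R$ is identifiable if $Q_{P_1}=Q_{P_2}$ implies $\theta(P_1)=\theta(P_2)$ for all $P_1,P_2\in\mathcal P$. The linear system. Vectors $\boldsymbol w^{\mathrm{add}}\in\mathbb R^{K^2M+M^K}$ are written as $\boldsymbol w^{\mathrm{add}}=\big(\{\omega_k(d,y)\}_{d\in\mathcal D,k\in\mathcal D,y\in\mathcal Y},\{\varpi(\boldsymbol y)\}_{\boldsymbol y\in\mathcal Y^{\mathcal D}}\big)$ (weight and intercept values). $\boldsymbol A^{\mathrm{add}}$ is the fixed $0$–$1$ matrix of size $KM^K\times(K^2M+M^K)$, with rows indexed by $(d,\boldsymbol y)\in\mathcal D\times\mathcal Y^{\mathcal D}$, such that $$(\boldsymbol A^{\mathrm{add}}\boldsymbol w^{\mathrm{add}})_{(d,\boldsymbol y)}=\varpi(\boldsymbol y)+\sum_{k\in\mathcal D}\omega_k(d,y_k).$$ *)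

(* Defs.v *)
From HB Require Import structures.
From mathcomp Require Import all_boot all_order all_algebra.
From mathcomp Require Import reals.

Set Implicit Arguments.
Unset Strict Implicit.
Unset Printing Implicit Defensive.

Import Order.TTheory GRing.Theory Num.Theory.
Local Open Scope ring_scope.

(* Delta(S): probability distributions on a finite set, given by their mass
   functions. *)
Record dist (R : realType) (S : finType) := Dist {
  mass :> S -> R ;
  mass_ge0 : forall x, 0 <= mass x ;
  mass_sum1 : \sum_x mass x = 1 }.

Definition prob (R : realType) (S : finType) (P : dist R S) (A : {set S}) : R :=
  \sum_(x in A) P x.

(* The vectors (y_0, ..., y_(K-1)) of potential outcomes. *)
Notation potential K M := {ffun 'I_K -> 'I_M}.

(* Joint laws of (D, Y(D)) : the first coordinate is the observed decision D
   and the second one is the whole vector of potential outcomes. *)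
Definition law (R : realType) (K M : nat) := dist R ('I_K * potential K M)%type.

Definition unconfounded (R : realType) (K M : nat) (P : law R K M) : Prop :=
  forall (A : {set 'I_K}) (B : {set potential K M}),
    prob P [set x | (x.1 \in A) && (x.2 \in B)] =
    prob P [set x | x.1 \in A] * prob P [set x | x.2 \in B].

Definition overlap (R : realType) (K M : nat) (P : law R K M) : Prop :=
  forall d : 'I_K, 0 < prob P [set x | x.1 == d].

Definition strongly_ignorable (R : realType) (K M : nat) (P : law R K M) :
    Prop :=
  unconfounded P /\ overlap P.

(* Mass function of the observed pair (D, Y), where Y = Y(D) by consistency. *)
Definition observed_law (R : realType) (K M : nat) (P : law R K M) :
    {ffun 'I_K * 'I_M -> R} :=
  [ffun ky : 'I_K * 'I_M =>
     prob P [set x : 'I_K * potential K M | (x.1 == ky.1) && (x.2 ky.1 == ky.2)]].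

(* theta is total, but only its values on strongly ignorable laws matter. *)
Definition identifiable (R : realType) (K M : nat) (theta : law R K M -> R) :
    Prop :=
  forall P1 P2 : law R K M,
    strongly_ignorable P1 -> strongly_ignorable P2 ->
    observed_law P1 = observed_law P2 -> theta P1 = theta P2.

Definition risk (R : realType) (K M : nat) (P : law R K M) (pi : dist R 'I_K)
    (l : 'I_K -> potential K M -> R) : R :=
  \sum_(d : 'I_K) \sum_(y : potential K M)
    l d y * pi d * prob P [set x | x.2 == y].

Notation row_index K M := ('I_K * potential K M)%type.

(* inl (k, d, y) is the position of omega_k(d, y), and inr y that of the
   intercept varpi(y). *)
Notation col_index K M :=
  ('I_K * 'I_K * 'I_M + potential K M)%type.

Lemma card_row_index K M : #|{: row_index K M}| = (K * M ^ K)%N.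
Proof. by rewrite card_prod card_ffun !card_ord. Qed.

Lemma card_col_index K M : #|{: col_index K M}| = (K ^ 2 * M + M ^ K)%N.
Proof. by rewrite card_sum !card_prod card_ffun !card_ord. Qed.

(* Entry of the additive matrix in row (d, y). *)
Definition add_entry (R : realType) (K M : nat)
    (r : row_index K M) (c : col_index K M) : R :=
  let: (d, y) := r in
  match c with
  | inl (k, d', y') => ((d' == d) && (y' == y k))%:R
  | inr y' => (y' == y)%:R
  end.

(* Matrix and vector positions are ordinals; enum_val enumerates the row and
   column index sets. *)
Definition add_matrix (R : realType) (K M : nat) :
    'M[R]_(#|{: row_index K M}|, #|{: col_index K M}|) :=
  \matrix_(i, j) add_entry R (enum_val i) (enum_val j).

Definition loss_vector (R : realType) (K M : nat)
    (l : 'I_K -> potential K M -> R) : 'cV[R]_(#|{: row_index K M}|) :=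
  \col_i l (enum_val i).1 (enum_val i).2.

(* The defining action of the matrix:
   (A w)_(d, y) = varpi(y) + \sum_k omega_k(d, y_k). *)
Lemma add_matrixE (R : realType) (K M : nat) (w : 'cV[R]_(#|{: col_index K M}|))
    (d : 'I_K) (y : potential K M) :
  (add_matrix R K M *m w) (enum_rank ((d, y) : row_index K M)) 0 =
  w (enum_rank (inr y : col_index K M)) 0 +
  \sum_(k : 'I_K) w (enum_rank (inl (k, d, y k) : col_index K M)) 0.
Proof.
rewrite mxE (reindex_onto enum_rank enum_val) /=; last first.
  by move=> i _; rewrite enum_valK.
under eq_bigl => c do rewrite enum_rankK eqxx.
under eq_bigr => c _ do rewrite mxE !enum_rankK.
rewrite big_sumType /= addrC; congr (_ + _).
  rewrite (bigD1 y) //= eqxx mul1r big1 ?addr0 // => y' /negPf ->.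
  by rewrite mul0r.
transitivity (\sum_(k : 'I_K) \sum_(d' : 'I_K) \sum_(y' : 'I_M)
   ((d' == d) && (y' == y k))%:R *
   w (enum_rank (inl (k, d', y') : col_index K M)) 0).
  by rewrite pair_big pair_big /=; apply: eq_bigr => -[[k d'] y'] _.
apply: eq_bigr => k _; rewrite (bigD1 d) //= [X in _ + X]big1 ?addr0.
  rewrite (bigD1 (y k)) //= !eqxx mul1r big1 ?addr0 // => y' /negPf ->.
  by rewrite andbF mul0r.
by move=> d' /negPf ->; rewrite big1 // => y' _; rewrite mul0r.
Qed.

(* Main.v *)
Require Import Defs.
From mathcomp Require Import all_boot all_order all_algebra.
From mathcomp Require Import reals.
From mathcomp Require Import ring.

Set Implicit Arguments.
Unset Strict Implicit.
Unset Printing Implicit Defensive.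

Import Order.TTheory GRing.Theory Num.Theory.
Local Open Scope ring_scope.

(** Under strong ignorability a law is a product p x q of the decision law p
    and the law q of the potential outcome vector; the observed law determines
    p and, since p is positive, the one-dimensional marginals of q
    ([marginal_identified]), but nothing more about q. The risk difference of
    pi and rho is the sum over d of (pi d - rho d) E_q[l(d; y)].

    If l(d; y) = varpi(y) + sum_k omega_k(d, y_k), the intercept cancels
    because pi and rho have the same total mass, and the remaining terms are
    expectations under the marginals of q, hence identified.

    Conversely, comparing the point masses at d and at a reference decision d0
    shows that E_q[g_d], where g_d(y) = l(d; y) - l(d0; y), depends on the
    marginals of q only. Fix a reference vector y0, and let y0[k := v] be y0
    with its k-th entry replaced by v. The uniform law on the K points
    y, y0, ..., y0 and the uniform law on the K points y0[k := y_k] have the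
    same marginals: in each coordinate k both give one y_k and K - 1 copies of
    the k-th entry of y0. Equality of the two expectations of g_d reads
      g_d(y) + (K - 1) g_d(y0) = sum_k g_d(y0[k := y_k]),
    which exhibits g_d as a sum of functions of single coordinates
    ([contrast_interpolation]). Adding back varpi(y) = l(d0; y) solves the
    system. *)

(** * Expectations and marginals *)

Lemma sum_mul_prob (R : realType) (S T : finType) (P : dist R S)
    (A : {set S}) (h : S -> T) (g : T -> R) :
  \sum_t g t * prob P [set x | (x \in A) && (h x == t)] =
  \sum_(x in A) g (h x) * P x.
Proof.
rewrite [RHS](partition_big h predT) //=; apply: eq_bigr => t _.
rewrite /prob big_distrr /=; apply: eq_big => [x|x]; rewrite inE //.
by case/andP => _ /eqP ->.
Qed.

Lemma sum_mul_probT (R : realType) (S T : finType) (P : dist R S)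
    (h : S -> T) (g : T -> R) :
  \sum_t g t * prob P [set x | h x == t] = \sum_x g (h x) * P x.
Proof.
transitivity (\sum_(x in [set: S]) g (h x) * P x).
  rewrite -sum_mul_prob; apply: eq_bigr => t _; congr (_ * prob _ _).
  by apply/setP => x; rewrite !inE.
by apply: eq_bigl => x; rewrite inE.
Qed.

Lemma risk_expectation (R : realType) (K M : nat) (P : law R K M)
    (pi : dist R 'I_K) (l : 'I_K -> potential K M -> R) :
  risk P pi l = \sum_d pi d * \sum_x l d x.2 * P x.
Proof.
apply: eq_bigr => d _; rewrite -(sum_mul_probT P snd) big_distrr /=.
by apply: eq_bigr => y _; ring.
Qed.

Lemma sum_observed_law (R : realType) (K M : nat) (P : law R K M) (k : 'I_K) :
  \sum_v observed_law P (k, v) = prob P [set x | x.1 == k].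
Proof.
transitivity (\sum_(x in [set x : 'I_K * potential K M | x.1 == k]) 1 * P x).
  rewrite -(sum_mul_prob P _ (fun x : 'I_K * potential K M => x.2 k) (fun=> 1)).
  apply: eq_bigr => v _; rewrite ffunE mul1r; congr (prob _ _).
  by apply/setP => x; rewrite !inE.
by apply: eq_bigr => x _; rewrite mul1r.
Qed.

Definition marginal (R : realType) (K M : nat) (P : law R K M)
    (k : 'I_K) (v : 'I_M) : R :=
  prob P [set x : 'I_K * potential K M | x.2 k == v].

Lemma sum_mul_marginal (R : realType) (K M : nat) (P : law R K M)
    (k : 'I_K) (g : 'I_M -> R) :
  \sum_v g v * marginal P k v = \sum_(x : 'I_K * potential K M) g (x.2 k) * P x.
Proof. exact: (sum_mul_probT P (fun x : 'I_K * potential K M => x.2 k)). Qed.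

Lemma observed_law_prod (R : realType) (K M : nat) (P : law R K M)
    (k : 'I_K) (v : 'I_M) :
  unconfounded P ->
  observed_law P (k, v) =
  prob P [set x | x.1 == k] * marginal P k v.
Proof.
move=> unc; rewrite ffunE.
apply: (etrans _ (etrans (unc [set k] [set y : potential K M | y k == v]) _)).
  by congr (prob P _); apply/setP => x; rewrite !inE.
by congr (prob P _ * prob P _); apply/setP => x; rewrite !inE.
Qed.

(** Dividing the observed mass of (k, v) by the positive probability of k,
    itself the total observed mass of the pairs (k, _), recovers the law of
    the k-th potential outcome. *)
Lemma marginal_identified (R : realType) (K M : nat) (P1 P2 : law R K M)
    (k : 'I_K) (v : 'I_M) :
  strongly_ignorable P1 -> strongly_ignorable P2 ->
  observed_law P1 = observed_law P2 ->
  marginal P1 k v = marginal P2 k v.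
Proof.
move=> [unc1 _] [unc2 ov2] obs.
have dec : prob P1 [set x | x.1 == k] = prob P2 [set x | x.1 == k].
  by rewrite -!sum_observed_law obs.
apply: (mulfI (lt0r_neq0 (ov2 k))).
by rewrite -{1}dec -!observed_law_prod // obs.
Qed.

(** * Additive losses have identifiable risk differences *)

Lemma risk_additive (R : realType) (K M : nat) (P : law R K M)
    (pi : dist R 'I_K) (l : 'I_K -> potential K M -> R)
    (intercept : potential K M -> R) (weight : 'I_K -> 'I_K -> 'I_M -> R) :
  (forall d y, l d y = intercept y + \sum_k weight k d (y k)) ->
  risk P pi l =
  \sum_x intercept x.2 * P x +
  \sum_d pi d * \sum_k \sum_v weight k d v * marginal P k v.
Proof.
move=> lE; rewrite risk_expectation -[X in X + _]mul1r -(mass_sum1 pi).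
rewrite big_distrl -big_split /=; apply: eq_bigr => d _.
rewrite -mulrDr; congr (_ * _).
under [X in _ = _ + X]eq_bigr => k _ do rewrite sum_mul_marginal.
rewrite exchange_big -big_split /=; apply: eq_bigr => x _.
by rewrite lE mulrDl big_distrl.
Qed.

Lemma additive_identifiable (R : realType) (K M : nat) (pi rho : dist R 'I_K)
    (l : 'I_K -> potential K M -> R)
    (intercept : potential K M -> R) (weight : 'I_K -> 'I_K -> 'I_M -> R) :
  (forall d y, l d y = intercept y + \sum_k weight k d (y k)) ->
  identifiable (fun P : law R K M => risk P pi l - risk P rho l).
Proof.
move=> lE P1 P2 si1 si2 obs /=.
have cancel_intercept (a b c : R) : (a + b) - (a + c) = b - c by ring.
rewrite !(risk_additive _ _ lE) !cancel_intercept.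
by congr (_ - _); apply: eq_bigr => d _; congr (_ * _);
  apply: eq_bigr => k _; apply: eq_bigr => v _;
  rewrite (marginal_identified _ _ si1 si2 obs).
Qed.

(** * Laws uniform on finitely many points *)

Section Empirical.
Variables (R : realType) (I S : finType) (i0 : I) (h : I -> S).

Lemma card_inv_neq0 : #|I|%:R != 0 :> R.
Proof. by rewrite pnatr_eq0 -lt0n; apply/card_gt0P; exists i0. Qed.

Definition empirical_mass (x : S) : R := #|I|%:R^-1 * \sum_i (h i == x)%:R.

Lemma empirical_mass_ge0 x : 0 <= empirical_mass x.
Proof. by rewrite mulr_ge0 ?invr_ge0 ?ler0n ?sumr_ge0. Qed.

Lemma sum_mul_empirical_mass (g : S -> R) :
  \sum_x g x * empirical_mass x = #|I|%:R^-1 * \sum_i g (h i).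
Proof.
under eq_bigr => x _ do rewrite mulrCA big_distrr.
rewrite -big_distrr exchange_big /=; congr (_ * _); apply: eq_bigr => i _.
rewrite (bigD1 (h i)) //= eqxx mulr1 big1 ?addr0 // => x.
by rewrite eq_sym => /negPf ->; rewrite mulr0.
Qed.

Lemma empirical_mass_sum1 : \sum_x empirical_mass x = 1.
Proof.
under eq_bigr => x _ do rewrite -[empirical_mass x]mul1r.
by rewrite (sum_mul_empirical_mass (fun=> 1)) sumr_const mulVf ?card_inv_neq0.
Qed.

(** The average of the point masses at the values of [h], with multiplicity;
    [i0] witnesses that there is at least one. *)
Definition empirical : dist R S := Dist empirical_mass_ge0 empirical_mass_sum1.

Lemma prob_empirical (A : {set S}) :
  prob empirical A = #|I|%:R^-1 * \sum_i (h i \in A)%:R.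
Proof.
rewrite -(sum_mul_empirical_mass (fun x => (x \in A)%:R)) /prob big_mkcond.
by apply: eq_bigr => x _; case: (x \in A); rewrite ?mul1r ?mul0r.
Qed.

End Empirical.

(** The uniform decision, independent of an outcome vector drawn uniformly
    among the values of [f]. *)
Definition product_law (R : realType) (K M : nat) (k0 : 'I_K)
    (f : 'I_K -> potential K M) : law R K M :=
  empirical R (k0, k0) (fun i : 'I_K * 'I_K => (i.1, f i.2)).

Lemma prob_product_law (R : realType) (K M : nat) (k0 : 'I_K)
    (f : 'I_K -> potential K M) (a : pred 'I_K) (b : pred (potential K M)) :
  prob (product_law R k0 f) [set x | a x.1 && b x.2] =
  (K%:R^-1 * \sum_d (a d)%:R) * (K%:R^-1 * \sum_j (b (f j))%:R).
Proof.
rewrite prob_empirical card_prod card_ord natrM invfM.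
rewrite mulrACA; congr (_ * _); rewrite big_distrlr /= pair_big /=.
by apply: eq_bigr => i _; rewrite inE /= -natrM mulnb.
Qed.

Lemma strongly_ignorable_product_law (R : realType) (K M : nat) (k0 : 'I_K)
    (f : 'I_K -> potential K M) :
  strongly_ignorable (product_law R k0 f).
Proof.
have K0 : K%:R != 0 :> R by have := card_inv_neq0 R k0; rewrite card_ord.
have Kc : K%:R^-1 * \sum_(j < K) true%:R = 1 :> R.
  by rewrite sumr_const card_ord mulVf.
have pD a : prob (product_law R k0 f) [set x | a x.1] =
    K%:R^-1 * \sum_d (a d)%:R.
  rewrite -[RHS]mulr1 -[X in _ = _ * X]Kc;
  apply: (etrans _ (prob_product_law R k0 f a predT)).
  by congr (prob _ _); apply/setP => x; rewrite !inE andbT.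
have pY b : prob (product_law R k0 f) [set x | b x.2] =
    K%:R^-1 * \sum_j (b (f j))%:R.
  rewrite -[RHS]mul1r -[X in _ = X * _]Kc;
  apply: (etrans _ (prob_product_law R k0 f predT b)).
  by congr (prob _ _); apply/setP => x; rewrite !inE.
split=> [A B|d].
  by rewrite (prob_product_law _ _ _ (mem A) (mem B)) (pD (mem A))
    (pY (mem B)).
rewrite (pD (pred1 d)) (bigD1 d) //= eqxx big1 => [|i /negPf -> //].
by rewrite addr0 mulr1 invr_gt0 lt0r K0 ler0n.
Qed.

Lemma observed_law_product_law (R : realType) (K M : nat) (k0 : 'I_K)
    (f1 f2 : 'I_K -> potential K M) :
  (forall k v, \sum_j (f1 j k == v)%:R = \sum_j (f2 j k == v)%:R :> R) ->
  observed_law (product_law R k0 f1) =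
  observed_law (product_law R k0 f2).
Proof.
move=> eq_marg; apply/ffunP => -[k v]; rewrite !ffunE /=.
by rewrite !(prob_product_law _ _ _ (pred1 k) (fun y => y k == v)) /=
  eq_marg.
Qed.

(** * Identifiability forces additivity *)

Definition point_mass (R : realType) (K : nat) (d : 'I_K) : dist R 'I_K :=
  empirical R tt (fun=> d).

Lemma risk_point_mass (R : realType) (K M : nat) (d k0 : 'I_K)
    (f : 'I_K -> potential K M) (l : 'I_K -> potential K M -> R) :
  risk (product_law R k0 f) (point_mass R d) l =
  K%:R^-1 * \sum_j l d (f j).
Proof.
have K0 : K%:R != 0 :> R by have := card_inv_neq0 R k0; rewrite card_ord.
rewrite risk_expectation.
under eq_bigr => d' _ do rewrite mulrC.
rewrite sum_mul_empirical_mass card_unit invr1 mul1r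
  big_const card_unit /= addr0.
rewrite (sum_mul_empirical_mass _ (fun x => l d x.2)) card_prod card_ord.
rewrite -(pair_big predT predT (fun _ j => l d (f j))) /= sumr_const card_ord.
by rewrite natrM; field.
Qed.

Definition update (K M : nat) (y : potential K M) (k : 'I_K) (v : 'I_M) :
  potential K M := [ffun j => if j == k then v else y j].

Lemma sum_if_eq (R : realType) (K : nat) (a : 'I_K) (u w : R) :
  \sum_j (if j == a then u else w) = u + K.-1%:R * w.
Proof.
rewrite (bigD1 a) //= eqxx; congr (_ + _).
rewrite (eq_bigr (fun=> w)) => [|j /negPf -> //].
by rewrite sumr_const cardC1 card_ord mulr_natl.
Qed.

(** The laws uniform on y, y0, ..., y0 and on the vectors y0[k := y_k] are
    observationally equivalent, so a contrast of decisions with identifiable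
    risk difference has the same average on both. *)
Lemma contrast_interpolation (R : realType) (K M : nat) (d d0 : 'I_K)
    (l : 'I_K -> potential K M -> R) (y y0 : potential K M) :
  identifiable (fun P : law R K M =>
    risk P (point_mass R d) l - risk P (point_mass R d0) l) ->
  (l d y - l d0 y) + K.-1%:R * (l d y0 - l d0 y0) =
  \sum_k (l d (update y0 k (y k)) - l d0 (update y0 k (y k))).
Proof.
move=> idf; have K0 : K%:R != 0 :> R.
  by have := card_inv_neq0 R d; rewrite card_ord.
pose f1 (j : 'I_K) := if j == d0 then y else y0.
pose f2 (j : 'I_K) := update y0 j (y j).
have marg (k : 'I_K) (v : 'I_M) :
    \sum_j (f1 j k == v)%:R = \sum_j (f2 j k == v)%:R :> R.
  transitivity ((y k == v)%:R + K.-1%:R * (y0 k == v)%:R : R).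
    rewrite -(sum_if_eq d0); apply: eq_bigr => j _.
    by rewrite /f1; case: (j == d0).
  rewrite -(sum_if_eq k); apply: eq_bigr => j _.
  by rewrite /f2 ffunE eq_sym; case: eqP => // ->.
have := idf _ _ (strongly_ignorable_product_law R d0 f1)
  (strongly_ignorable_product_law R d0 f2)
  (observed_law_product_law d0 marg).
rewrite !risk_point_mass -!mulrBr -!sumrB => /(mulfI (invr_neq0 K0)) <-.
rewrite -(sum_if_eq d0); apply: eq_bigr => j _.
by rewrite /f1; case: (j == d0).
Qed.

(** * The linear system *)

(** A column vector is a family of weights and intercepts read through the
    enumeration of the column positions, so that [add_matrixE] translates the
    system row by row. *)
Lemma add_systemP (R : realType) (K M : nat)
    (l : 'I_K -> potential K M -> R) :
  (exists w : 'cV[R]_(#|{: col_index K M}|),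
     add_matrix R K M *m w = loss_vector l) <->
  (exists (intercept : potential K M -> R) (weight : 'I_K -> 'I_K -> 'I_M -> R),
     forall d y, l d y = intercept y + \sum_k weight k d (y k)).
Proof.
split=> [[w wE]|[intercept [weight lE]]].
  exists (fun y => w (enum_rank (inr y : col_index K M)) 0).
  exists (fun k d v => w (enum_rank (inl (k, d, v) : col_index K M)) 0) => d y.
  by rewrite -add_matrixE wE mxE enum_rankK.
exists (\col_j match (enum_val j : col_index K M) with
  | inl (k, d, v) => weight k d v
  | inr y => intercept y
  end).
apply/matrixP => i j; rewrite ord1 -[i]enum_valK.
case: (enum_val i) => d y; rewrite add_matrixE !mxE !enum_rankK lE.
by congr (_ + _); apply: eq_bigr => k _; rewrite mxE enum_rankK.
Qed.

Theorem corollary5 (R : realType) (K M : nat) (hK : (2 <= K)%N) (hM : (2 <= M)%N)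
    (l : 'I_K -> potential K M -> R) :
  (forall pi rho : dist R 'I_K,
     identifiable (fun P : law R K M => risk P pi l - risk P rho l)) <->
  (exists w : 'cV[R]_(#|{: col_index K M}|),
     add_matrix R K M *m w = loss_vector l).
Proof.
rewrite add_systemP; split=> [idf|[intercept [weight lE]] pi rho]; last first.
  exact: additive_identifiable lE.
pose d0 : 'I_K := Ordinal (ltnW hK).
pose y0 : potential K M := [ffun=> Ordinal (ltnW hM)].
have K0 : K%:R != 0 :> R by have := card_inv_neq0 R d0; rewrite card_ord.
pose g d y := l d y - l d0 y.
(* The constant (K - 1) g_d(y0) of the interpolation identity is spread evenly
   over the K weights. *)
exists (l d0), (fun k d v => g d (update y0 k v) - K.-1%:R * g d y0 / K%:R).
move=> d y.
rewrite big_split /= sumr_const card_ord.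
rewrite -(@contrast_interpolation R K M d d0 l y y0 (idf _ _)).
by rewrite /g -mulr_natr; field.
Qed.
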